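(* Let $\mathcal{D}=\lbrace(x_k,y_k)\rbrace_{k=1}^M$ be a dataset with $x_k\in\mathbb{R}^n$ and $y_k\in\lbrace0,1\rbrace$, and let $f$ and $u_k=\nabla f_k$ be the associated logistic regression objective and single-sample gradients. If $\mathcal{D}$ satisfies the features consistency property, then the single element gradient estimate $\widetilde{\nabla} f(\theta)=u_\xi(\theta)$, $\xi\in\lbrace1,\dots,M\rbrace$, satisfies the direction condition: there is $\gamma\in(0,1]$ such that for every $\xi\in\lbrace1,\dots,M\rbrace$ and every $\theta\in\mathbb{R}^n$ $$\langle u_\xi(\theta),\nabla f(\theta)\rangle\geqslant\gamma\|u_\xi(\theta)\|_2\|\nabla f(\theta)\|_2 .$$
   Context: Logistic regression: $\sigma(t)=\frac{1}{1+e^{-t}}$; $f_k(\theta)=y_k\ln\sigma(x_k^T\theta)+(1-y_k)\ln\left(1-\sigma(x_k^T\theta)\right)$; $f(\theta)=\frac1M\sum_{k=1}^Mf_k(\theta)$; $u_k(\theta)=\nabla f_k(\theta)=x_k\left(y_k\left(1-\sigma(x_k^T\theta)\right)-(1-y_k)\sigma(x_k^T\theta)\right)$. Features consistency of $\mathcal{D}$: there exists $\Upsilon\in(0,1]$ such that for all $i,k\in\lbrace1,\dots,M\rbrace$: if $y_i=y_k$ then $\langle x_i,x_k\rangle\geqslant\Upsilon\|x_i\|_2\|x_k\|_2$, and if $y_i\neq y_k$ then $\langle x_i,x_k\rangle\leqslant-\Upsilon\|x_i\|_2\|x_k\|_2$. *)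

(* Defs.v *)
From HB Require Import structures.
From mathcomp Require Import all_boot all_order all_algebra.
From mathcomp Require Import all_classical all_reals all_analysis.

Set Implicit Arguments.
Unset Strict Implicit.
Unset Printing Implicit Defensive.

Import Order.TTheory GRing.Theory Num.Theory.
Import numFieldNormedType.Exports.

Local Open Scope ring_scope.

(* The library's norm `|u| on 'rV[R]_n is the max norm, hence the separate
   Euclidean norm [norm2]. *)
Definition dot {R : realType} {n : nat} (u v : 'rV[R]_n) : R :=
  (u *m v^T) 0 0.

Definition norm2 {R : realType} {n : nat} (u : 'rV[R]_n) : R :=
  Num.sqrt (dot u u).

(* The vector of partial derivatives. As 'D_v is a total operator, this is
   meaningful only where the partial derivatives exist. *)
Definition grad {R : realType} {n : nat} (f : 'rV[R]_n -> R)
    (theta : 'rV[R]_n) : 'rV[R]_n :=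
  \row_(j < n) ('D_('e_j) f theta : R).

Definition sigmoid {R : realType} (t : R) : R := 1 / (1 + expR (- t)).

(* A dataset is given by features [x] and labels [y]; a label is a boolean,
   read in R as 0 or 1 through %:R. *)
Definition sample_objective {R : realType} {n M : nat}
    (x : 'I_M -> 'rV[R]_n) (y : 'I_M -> bool) (k : 'I_M)
    (theta : 'rV[R]_n) : R :=
  (y k)%:R * ln (sigmoid (dot (x k) theta)) +
  (1 - (y k)%:R) * ln (1 - sigmoid (dot (x k) theta)).

Definition objective {R : realType} {n M : nat}
    (x : 'I_M -> 'rV[R]_n) (y : 'I_M -> bool) (theta : 'rV[R]_n) : R :=
  1 / M%:R * \sum_(k < M) sample_objective x y k theta.

Definition sample_grad {R : realType} {n M : nat}
    (x : 'I_M -> 'rV[R]_n) (y : 'I_M -> bool) (k : 'I_M) :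
    'rV[R]_n -> 'rV[R]_n :=
  grad (sample_objective x y k).

Definition features_consistent {R : realType} {n M : nat}
    (x : 'I_M -> 'rV[R]_n) (y : 'I_M -> bool) : Prop :=
  exists Upsilon : R, 0 < Upsilon <= 1 /\
    forall i k : 'I_M,
      (y i = y k -> Upsilon * norm2 (x i) * norm2 (x k) <= dot (x i) (x k)) /\
      (y i <> y k ->
         dot (x i) (x k) <= - Upsilon * norm2 (x i) * norm2 (x k)).

(* Main.v *)
Require Import Defs.
From HB Require Import structures.
From mathcomp Require Import all_boot all_order all_algebra.
From mathcomp Require Import all_classical all_reals all_analysis.
From mathcomp Require Import ring.

Set Implicit Arguments.
Unset Strict Implicit.
Unset Printing Implicit Defensive.

Import Order.TTheory GRing.Theory Num.Theory.
Import numFieldNormedType.Exports.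

Local Open Scope ring_scope.

(** Absorb the labels into the features: with [z_k = - x_k] if [y_k = 1] and
    [z_k = x_k] if [y_k = 0], the sample objective is
    [f_k(theta) = - ln (1 + exp <z_k, theta>)], so that every [u_k(theta)] is a
    nonpositive multiple of [z_k], and consistency says that
    [<z_i, z_k> >= Upsilon |z_i| |z_k|] for all [i, k]. The same inequality
    then holds between the [u_k(theta)]; summing over [k] and applying the
    triangle inequality to [sum_k u_k(theta)] gives the direction condition
    with [gamma = Upsilon]. *)

Section Dot.
Variables (R : realType) (n : nat).
Implicit Types (u v w : 'rV[R]_n) (a : R).

Lemma dotE u v : dot u v = \sum_(j < n) u 0 j * v 0 j.
Proof. by rewrite /dot mxE; apply: eq_bigr => j _; rewrite mxE. Qed.

Lemma dotC u v : dot u v = dot v u.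
Proof. by rewrite !dotE; apply: eq_bigr => j _; rewrite mulrC. Qed.

Lemma dotDr u v w : dot u (v + w) = dot u v + dot u w.
Proof. by rewrite /dot linearD mulmxDr mxE. Qed.

Lemma dotZr a u v : dot u (a *: v) = a * dot u v.
Proof. by rewrite /dot linearZ -scalemxAr mxE. Qed.

Lemma dotDl u v w : dot (u + v) w = dot u w + dot v w.
Proof. by rewrite dotC dotDr !(dotC w). Qed.

Lemma dotZl a u v : dot (a *: u) v = a * dot u v.
Proof. by rewrite dotC dotZr dotC. Qed.

Lemma dot_sumr (I : finType) u (F : I -> 'rV[R]_n) :
  dot u (\sum_i F i) = \sum_i dot u (F i).
Proof. by rewrite /dot linear_sum mulmx_sumr summxE. Qed.

Lemma dot_delta u (j : 'I_n) : dot u 'e_j = u 0 j.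
Proof.
rewrite dotE (bigD1 j) //= mxE !eqxx mulr1 big1 ?addr0 // => i ij.
by rewrite mxE (negPf ij) andbF mulr0.
Qed.

Lemma dot_ge0 u : 0 <= dot u u.
Proof. by rewrite dotE sumr_ge0 // => j _; rewrite -expr2 sqr_ge0. Qed.

Lemma norm2_ge0 u : 0 <= norm2 u.
Proof. exact: sqrtr_ge0. Qed.

Lemma sqr_norm2 u : norm2 u ^+ 2 = dot u u.
Proof. by rewrite sqr_sqrtr ?dot_ge0. Qed.

Lemma norm2Z a u : norm2 (a *: u) = `|a| * norm2 u.
Proof.
by rewrite /norm2 dotZl dotZr mulrA -expr2 sqrtrM ?sqr_ge0 // sqrtr_sqr.
Qed.

(** The two minus signs cancel in the dot product and vanish in the norms, so both sides are just
    multiplied by [a * b]. This carries alignment from the signed features over to the gradients. *)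
Lemma aligned_scale (c a b : R) u v : 0 <= a -> 0 <= b ->
  c * norm2 u * norm2 v <= dot u v ->
  c * norm2 (- a *: u) * norm2 (- b *: v) <= dot (- a *: u) (- b *: v).
Proof.
move=> a0 b0 /(ler_wpM2l (mulr_ge0 a0 b0)).
rewrite !norm2Z !normrN !ger0_norm // dotZl dotZr mulrA mulrNN.
by apply: le_trans; rewrite le_eqVlt; apply/orP; left; apply/eqP; ring.
Qed.

Lemma norm2_eq0 u : norm2 u = 0 -> u = 0.
Proof.
move=> u0; have := sqr_norm2 u; rewrite u0 expr0n /= dotE => /esym/eqP.
rewrite psumr_eq0 => [/allP z|j _]; last by rewrite -expr2 sqr_ge0.
apply/rowP => j; have := z j; rewrite mem_index_enum => /(_ isT) /=.
by rewrite mulf_eq0 orbb mxE => /eqP.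
Qed.

(** Cauchy-Schwarz: for nonzero vectors, the squared norm of [|v| u - |u| v] expands to
    [2 |u| |v| (|u| |v| - <u, v>)], and the positive factor [2 |u| |v|] can be divided out. *)
Lemma dot_le_norm2 u v : dot u v <= norm2 u * norm2 v.
Proof.
have [/norm2_eq0->|u0] := eqVneq (norm2 u) 0.
  by rewrite -(scale0r 0) dotZl mul0r mulr_ge0 ?norm2_ge0.
have [/norm2_eq0->|v0] := eqVneq (norm2 v) 0.
  by rewrite -(scale0r 0) dotZr mul0r mulr_ge0 ?norm2_ge0.
have uv_gt0 : 0 < norm2 u * norm2 v by rewrite mulr_gt0 // lt0r ?u0 ?v0 norm2_ge0.
rewrite -subr_ge0 -(pmulr_rge0 _ uv_gt0) -(pmulr_rge0 _ (ltr0n R 2)).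
have := dot_ge0 (norm2 v *: u + (- norm2 u) *: v).
rewrite !(dotDl, dotDr, dotZl, dotZr) (dotC v u) -!sqr_norm2.
by congr (_ <= _); ring.
Qed.

Lemma norm2_sum (I : finType) (F : I -> 'rV[R]_n) :
  norm2 (\sum_i F i) <= \sum_i norm2 (F i).
Proof.
have S0 : 0 <= \sum_i norm2 (F i) by rewrite sumr_ge0 // => i _; exact: norm2_ge0.
(* After squaring, both sides are double sums over pairs of indices, compared term by term through
   Cauchy-Schwarz. *)
rewrite -(ler_pXn2r (ltn0Sn 1)) ?nnegrE ?norm2_ge0 // sqr_norm2 dot_sumr expr2.
rewrite mulr_sumr; apply: ler_sum => k _.
rewrite dotC dot_sumr mulr_suml; apply: ler_sum => i _.
by rewrite dotC dot_le_norm2.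
Qed.

End Dot.

(** Both derivatives are limits of the same difference quotient. Restricting to a line makes the
    one-variable chain rule available for directional derivatives. *)
Lemma is_derive1P (R : numFieldType) (V W : normedModType R) (f : V -> W)
    (a v : V) (df : W) :
  is_derive a v f df <->
  is_derive (0 : R) (1 : R) (fun h : R => f (h *: v + a)) df.
Proof.
have E : 'D_v f a = 'D_1 (fun h : R => f (h *: v + a)) (0 : R).
  rewrite /derive; set q := (fun h => _); set q' := (fun h => _).
  suff -> : q = q' by [].
  by apply/funext => h; rewrite /q /q' /= addr0 scale0r add0r [_%:A]mulr1.
have [fwd bwd] := derivable1P f a v.
by split=> -[fav <-]; split=> //; [exact: fwd|exact: bwd].
Qed.

Section Ridge.
Variables (R : realType) (n : nat).

(** Along the line through [theta] in direction [v], the function is [g] composed with an affine map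
    of slope [<z, v>]. *)
Lemma is_derive_ridge (g : R -> R) (dg : R) (z theta v : 'rV[R]_n) :
  is_derive (dot z theta) 1 g dg ->
  is_derive theta v (fun t => g (dot z t)) (dot z v * dg).
Proof.
move=> gd; apply/is_derive1P.
have -> : (fun h : R => g (dot z (h *: v + theta))) =
    g \o (fun h => h * dot z v + dot z theta).
  by apply/funext => h /=; rewrite dotDr dotZr.
have lin : is_derive (0 : R) 1 (fun h => h * dot z v + dot z theta) (dot z v).
  have -> : (fun h => h * dot z v + dot z theta) =
      dot z v \*: id + cst (dot z theta).
    by apply/funext => h /=; rewrite mulrC.
  by apply: is_derive_eq; rewrite addr0 [_%:A]mulr1.
rewrite mulrC; apply: is_derive1_comp.
by rewrite mul0r add0r.
Qed.

End Ridge.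

Section Softplus.
Variable R : realType.

Definition softplus (t : R) : R := ln (1 + expR t).

Lemma is_derive_softplus (t : R) :
  is_derive t 1 softplus (expR t / (1 + expR t)).
Proof.
have t0 : 0 < 1 + expR t by rewrite addr_gt0 ?expR_gt0.
have d1 : is_derive t 1 (cst 1 + expR) (expR t).
  by apply: is_derive_eq; rewrite add0r.
have d2 : is_derive ((cst 1 + expR) t) 1 (@ln R) (1 + expR t)^-1.
  exact: is_derive1_ln t0.
by rewrite mulrC; exact: (is_derive1_comp d2 d1).
Qed.

Lemma ln_sigmoid (t : R) : ln (sigmoid t) = - softplus (- t).
Proof. by rewrite /sigmoid div1r lnV // posrE addr_gt0 ?expR_gt0. Qed.

Lemma sigmoidN (t : R) : 1 - sigmoid t = sigmoid (- t).
Proof.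
have := expR_gt0 t => t0.
rewrite /sigmoid opprK expRN; field.
by rewrite !gt_eqF // addr_gt0.
Qed.

End Softplus.

Section Dataset.
Variables (R : realType) (n M : nat).
Variables (x : 'I_M -> 'rV[R]_n) (y : 'I_M -> bool).

Definition signed_feature (k : 'I_M) : 'rV[R]_n := (-1) ^+ y k *: x k.

(** This is the sigmoid at [<z_k, theta>], in the form in which it arises as the derivative of
    [softplus]. *)
Definition sample_weight (k : 'I_M) (theta : 'rV[R]_n) : R :=
  let e := expR (dot (signed_feature k) theta) in e / (1 + e).

(** The label keeps only one of the two logarithms; since [1 - sigmoid t = sigmoid (- t)], either
    one is [ln (sigmoid (- <z_k, theta>))]. *)
Lemma sample_objectiveE k theta :
  sample_objective x y k theta = - softplus (dot (signed_feature k) theta).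
Proof.
rewrite /sample_objective /signed_feature sigmoidN !ln_sigmoid dotZl opprK.
by case: (y k); rewrite ?(mulN1r, mul1r, subrr, subr0, mul0r, addr0, add0r).
Qed.

Lemma is_derive_sample k theta v :
  is_derive theta v (sample_objective x y k)
    (- (dot (signed_feature k) v * sample_weight k theta)).
Proof.
rewrite (funext (sample_objectiveE k)).
exact/is_deriveN/is_derive_ridge/is_derive_softplus.
Qed.

Lemma sample_gradE k theta :
  sample_grad x y k theta = - sample_weight k theta *: signed_feature k.
Proof.
apply/rowP => j; rewrite !mxE (@derive_val _ _ _ _ _ _ _ (is_derive_sample k theta _)).
by rewrite dot_delta mxE mulNr mulrC.
Qed.

Lemma grad_objectiveE theta :
  grad (objective x y) theta = M%:R^-1 *: \sum_k sample_grad x y k theta.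
Proof.
have objE : objective x y = M%:R^-1 \*: \sum_k sample_objective x y k.
  by apply/funext => t; rewrite /objective div1r fct_sumE.
apply/rowP => j; rewrite !mxE summxE objE.
rewrite (@derive_val _ _ _ _ _ _ _ (is_deriveZ _ (is_derive_sum
  (fun k => is_derive_sample k theta 'e_j)))).
congr (_ * _); apply: eq_bigr => k _.
by rewrite mxE (@derive_val _ _ _ _ _ _ _ (is_derive_sample k theta _)).
Qed.

Lemma signed_feature_consistent (U : R) :
  (forall i k : 'I_M,
      (y i = y k -> U * norm2 (x i) * norm2 (x k) <= dot (x i) (x k)) /\
      (y i <> y k -> dot (x i) (x k) <= - U * norm2 (x i) * norm2 (x k))) ->
  forall i k, U * norm2 (signed_feature i) * norm2 (signed_feature k)
    <= dot (signed_feature i) (signed_feature k).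
Proof.
move=> hU i k; have [heq hneq] := hU i k.
rewrite /signed_feature !norm2Z !normrX normrN1 !expr1n !mul1r dotZl dotZr.
rewrite mulrA -signr_addb.
have [yik|yik] := eqVneq (y i) (y k).
  by rewrite yik addbb mul1r; exact: heq.
have /eqP/hneq := yik; rewrite !mulNr => h.
by rewrite -negb_eqb yik expr1 mulN1r lerNr.
Qed.

Lemma sample_grad_consistent (U : R) theta :
  (forall i k, U * norm2 (signed_feature i) * norm2 (signed_feature k)
    <= dot (signed_feature i) (signed_feature k)) ->
  forall i k, U * norm2 (sample_grad x y i theta)
      * norm2 (sample_grad x y k theta)
    <= dot (sample_grad x y i theta) (sample_grad x y k theta).
Proof.
move=> hU i k.
have w0 l : 0 <= sample_weight l theta.
  by rewrite divr_ge0 ?addr_ge0 ?expR_ge0.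
by rewrite !sample_gradE; exact: aligned_scale.
Qed.

End Dataset.

Theorem theorem7p1 (R : realType) (n M : nat)
    (x : 'I_M -> 'rV[R]_n) (y : 'I_M -> bool)
    (hD : features_consistent x y) :
  exists gamma : R, 0 < gamma <= 1 /\
    forall (xi : 'I_M) (theta : 'rV[R]_n),
      gamma * norm2 (sample_grad x y xi theta)
            * norm2 (grad (objective x y) theta)
      <= dot (sample_grad x y xi theta) (grad (objective x y) theta).
Proof.
case: hD => U [U01 hU]; exists U; split=> // xi theta.
have U0 : 0 <= U by case/andP: U01 => /ltW.
have hu := sample_grad_consistent theta (signed_feature_consistent hU).
rewrite grad_objectiveE norm2Z dotZr dot_sumr ger0_norm ?invr_ge0 //.
rewrite mulrCA ler_wpM2l ?invr_ge0 //.
apply: (@le_trans _ _ (\sum_k U * norm2 (sample_grad x y xi theta)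
    * norm2 (sample_grad x y k theta))); last exact: ler_sum.
by rewrite -mulr_sumr ler_wpM2l ?mulr_ge0 ?norm2_ge0 ?norm2_sum.
Qed.
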